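(* For a positive integer $n$, let $\mathcal{P}(n)$ be the probability that a graph $\Gamma$ chosen uniformly at random from the $2^{\binom n2}$ labeled simple graphs on $n$ vertices has nontrivial group $\mathrm{Aut}^{\pi}(\Gamma)$. Then $\lim_{n\to\infty}\mathcal{P}(n)=0$.
   Context: $N(v)$ is the neighbourhood of $v$. $\mathrm{Aut}^{\pi}(\Gamma)$ is the group of bijections $\pi$ of the vertex set such that for every vertex $v$ there exists a vertex $w$ with $\pi(N(v))=N(w)$. *)

(* Defs.v *)
From HB Require Import structures.
From mathcomp Require Import all_boot all_order all_algebra all_fingroup.
From mathcomp Require Import classical_sets reals topology normedtype.

Set Implicit Arguments.
Unset Strict Implicit.
Unset Printing Implicit Defensive.

Export numFieldNormedType.Exports.

(* A labeled simple graph on the vertex set T is given by its edges, which are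
   two-element subsets of T; graph equality is equality of edge sets, not
   isomorphism. *)
Record sgraph (T : finType) := SGraph {
  edges : {set {set T}};
  card_edge : [forall e in edges, #|e| == 2]
}.

HB.instance Definition _ (T : finType) := [isSub for @edges T].
HB.instance Definition _ (T : finType) := [Finite of sgraph T by <:].

Lemma card_sgraph (T : finType) : #|{: sgraph T}| = 2 ^ 'C(#|T|, 2).
Proof.
rewrite card_sub -card_draws -card_powerset; apply: eq_card => E.
rewrite powersetE; apply/forall_inP/fintype.subsetP => h e eE; first by rewrite inE h.
by move: (h e eE); rewrite inE.
Qed.

Section AutPi.
Variables (T : finType) (G : sgraph T).

Definition adj : rel T := fun u v => [set u; v] \in edges G.

Lemma adjC : symmetric adj.
Proof. by move=> u v; rewrite /adj finset.setUC. Qed.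

Lemma adj_irr : irreflexive adj.
Proof.
move=> u; apply/negbTE/negP => uu.
by move/forall_inP: (card_edge G) => /(_ _ uu); rewrite finset.setUid cards1.
Qed.

Definition nbh (v : T) : {set T} := [set w | adj v w].

Definition autpi : {set {perm T}} :=
  [set p : {perm T} | [forall v, exists w, p @: nbh v == nbh w]].

Lemma autpiP (p : {perm T}) :
  reflect (forall v, exists w, p @: nbh v = nbh w) (p \in autpi).
Proof.
rewrite inE; apply: (iffP forallP) => h v.
  by have /existsP[w /eqP] := h v; exists w.
by have [w /eqP] := h v => hw; apply/existsP; exists w.
Qed.

Lemma autpi_group_set : group_set autpi.
Proof.
apply/group_setP; split=> [|p q /autpiP hp /autpiP hq]; apply/autpiP => v.
  by exists v; under eq_imset do rewrite perm1; rewrite imset_id.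
have [w hw] := hp v; have [x hx] := hq w; exists x.
by rewrite -hx -hw -imset_comp; apply: eq_imset => y; rewrite /= permM.
Qed.

Canonical autpi_group := Group autpi_group_set.

End AutPi.

(* Uniform measure on the labeled simple graphs with vertex set {0, ..., n-1};
   by card_sgraph the denominator is 2 ^ 'C(n, 2). *)
Definition prob_autpi_nontrivial (R : realType) (n : nat) : R :=
  (#|[set G : sgraph 'I_n | autpi_group G != 1%G]|%:R
     / #|{: sgraph 'I_n}|%:R)%R.

(* Main.v *)
(* If p(N(v)) = N(w v) for all v, then vx is an edge iff (w v)(p x) is.  When p
   moves at least 3m vertices, there is a set U of m vertices with p(U) disjoint
   from U, so the edges inside U are determined by the edges not inside U.  For
   fixed restrictions of w and p to U this has probability at most 2^-C(m,2).
   When p moves fewer than 3m vertices, either w v <> v for some v, and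
   then N(v) and N(w v) = p(N(v)) differ in fewer than 3m places, or p fixes
   every N(v) and any x moved by p has N(x) = N(p x).  Both give two distinct
   vertices with nearly equal neighbourhoods, which for a fixed exceptional set of
   size 3m has probability at most 2^-(n-2-3m).  With m = 8 (1 + floor(log2 n)),
   each of the two union bounds is at most 1/n once n >= 2^13. *)
Require Import Defs.
From mathcomp Require Import all_boot all_order all_algebra all_fingroup.
From mathcomp Require Import classical_sets reals topology normedtype.
From mathcomp Require Import zify.

Set Implicit Arguments.
Unset Strict Implicit.
Unset Printing Implicit Defensive.

Import Order.TTheory GRing.Theory Num.Theory.

(* The graphs in X are determined by their edges outside S. *)
Lemma card_sgraph_determined (T : finType) (X : {set sgraph T}) (S : {set {set T}}) :
    (forall e, e \in S -> #|e| = 2) ->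
    (forall e, e \in S -> exists2 e', e' \notin S &
       forall G, G \in X -> (e \in edges G) = (e' \in edges G)) ->
  #|X| * 2 ^ #|S| <= 2 ^ 'C(#|T|, 2).
Proof.
move=> S2 XS; pose P := [set e : {set T} | #|e| == 2].
have SP : S \subset P by apply/fintype.subsetP => e /S2 e2; rewrite inE e2.
rewrite -card_draws -/P -(cardsID S P) (finset.setIidPr SP) expnD mulnC.
rewrite leq_mul2l; apply/orP; right; rewrite -card_powerset.
rewrite -(@card_in_imset _ _ (fun G => edges G :\: S)).
  apply: subset_leq_card; apply/fintype.subsetP => _ /imsetP[G _ ->].
  rewrite powersetE finset.setSD //; apply/fintype.subsetP => e eG.
  by rewrite inE; move/forall_inP: (card_edge G); apply.
move=> G H GX HX eqGH; apply: val_inj => /=; apply/finset.setP => e.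
have eqD f : f \notin S -> (f \in edges G) = (f \in edges H).
  by move=> fS; move/finset.setP/(_ f): eqGH; rewrite !inE fS.
have [eS|/eqD //] := boolP (e \in S).
by have [f fS Xf] := XS e eS; rewrite !Xf // eqD.
Qed.

(** Union bound cleared of denominators: when [c] counts all graphs, each event has probability at
    most [1/b]. *)
Lemma card_bigcup_le (I T : finType) (F : I -> {set T}) (b c : nat) :
  (forall i, #|F i| * b <= c) -> #|\bigcup_i F i| * b <= #|I| * c.
Proof.
move=> Fc; apply: (@leq_trans ((\sum_i #|F i|) * b)).
  rewrite leq_mul2r; apply/orP; right.
  elim/big_ind2: _ => [|m A n B mA nB|//]; first by rewrite cards0.
  by rewrite (leq_trans (leq_card_setU A B)) // leq_add.
by rewrite big_distrl -sum_nat_const /=; apply: leq_sum.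
Qed.

Section Events.
Variable T : finType.
Implicit Types (G : sgraph T) (p : {perm T}).

(* In a triple (u, w, q), u enumerates U, and w, q stand for the restrictions to U of
   the maps v |-> w v and p. *)
Definition folded_clique (m : nat) (t : {ffun 'I_m -> T} * {ffun 'I_m -> T} * {ffun 'I_m -> T}) :
    {set sgraph T} :=
  let: (u, w, q) := t in
  [set G | [&& injectiveb u, [forall i, q i \notin codom u] &
    [forall i, forall j, adj G (u i) (u j) == adj G (w i) (q j)]]].

(** The exceptional set is encoded as the range of [D], so that the triples number
    [#|T| ^ (d + 2)]. *)
Definition near_twins (d : nat) (t : T * T * {ffun 'I_d -> T}) : {set sgraph T} :=
  let: (u, v, D) := t in
  [set G | (u != v) &&
    [forall x, (x \notin [:: u; v] ++ codom D) ==> (adj G u x == adj G v x)]].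

Lemma card_folded_clique m t :
  #|@folded_clique m t| * 2 ^ 'C(m, 2) <= 2 ^ 'C(#|T|, 2).
Proof.
case: t => [[u w] q]; have [->|[G0]] := set_0Vmem (folded_clique (u, w, q)).
  by rewrite cards0.
rewrite inE => /and3P[/injectiveP u_inj /forallP qu _].
pose U := [set u i | i : 'I_m].
have cU : #|U| = m by rewrite card_imset // card_ord.
pose S := [set e : {set T} | e \subset U & #|e| == 2].
have <- : #|S| = 'C(m, 2) by rewrite cards_draws cU.
apply: card_sgraph_determined => e; rewrite inE => /andP[eU /eqP e2] //.
have /cards2P[x [y [_ def_e]]] : #|e| == 2 by apply/eqP.
have [/imsetP[i _ def_x] /imsetP[j _ def_y]] : x \in U /\ y \in U.
  by split; apply: (fintype.subsetP eU); rewrite def_e !inE eqxx ?orbT.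
(* This set leaves [U] through [q j]. If [w i = q j] it is a singleton, never an edge, and still
   lies outside [S]. *)
exists [set w i; q j].
  rewrite inE; apply/negP => /andP[/fintype.subsetP/(_ (q j))].
  rewrite !inE eqxx orbT => /(_ isT) /imsetP[k _ qk].
  by have := qu j; rewrite qk codom_f.
move=> G; rewrite inE => /and3P[_ _ /forallP/(_ i)/forallP/(_ j)/eqP].
by rewrite /adj def_e def_x def_y.
Qed.

(** The pairs joining [v] to unexceptional vertices are determined by those at [u]. *)
Lemma card_near_twins d t :
  #|@near_twins d t| * 2 ^ (#|T| - (2 + d)) <= 2 ^ 'C(#|T|, 2).
Proof.
case: t => [[u v] D]; have [->|[G0]] := set_0Vmem (near_twins (u, v, D)).
  by rewrite cards0.
rewrite inE => /andP[uv _].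
pose B := [set x in [:: u; v] ++ codom D].
pose S := [set [set v; x] | x in ~: B].
have BE x : x \in ~: B -> [/\ x != u, x != v & x \notin [:: u; v] ++ codom D].
  rewrite !inE => xB; split=> //; first by apply: contra xB => ->.
  by apply: contra xB => ->; rewrite orbT.
have cS : #|T| - (2 + d) <= #|S|.
  rewrite card_in_imset => [|x y /BE[_ xv _] /BE[_ yv _] /finset.setP/(_ x)].
    rewrite -(cardsC B) leq_subLR leq_add2r cardsE.
    by rewrite (leq_trans (card_size _)) // size_cat size_codom card_ord.
  by rewrite !inE eqxx orbT (negPf xv) => /esym/eqP.
have leS : 2 ^ (#|T| - (2 + d)) <= 2 ^ #|S| by rewrite leq_exp2l.
apply: leq_trans (leq_mul (leqnn _) leS) _; apply: card_sgraph_determined.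
  by move=> _ /imsetP[x /BE[_ xv _] ->]; rewrite cards2 eq_sym xv.
move=> _ /imsetP[x /BE[xu xv xB] ->]; exists [set u; x].
  apply/imsetP => -[y /BE[yu yv _] /finset.setP/(_ u)].
  by rewrite !inE eqxx (negPf uv) [u == y]eq_sym (negPf yu).
by move=> G; rewrite inE => /andP[_ /forallP/(_ x)]; rewrite xB => /eqP.
Qed.

Definition psupp p : {set T} := [set x | p x != x].

(* Take U maximal with p(U) disjoint from U: then U, p(U) and the preimage of U
   cover the support. *)
Lemma psupp_displaced p m : 3 * m <= #|psupp p| ->
  exists u : {ffun 'I_m -> T}, injective u /\ forall i, p (u i) \notin codom u.
Proof.
move=> m_le; pose P (A : {set T}) := [forall x in A, p x \notin A].
have P0 : P finset.set0 by apply/forall_inP => x; rewrite inE.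
have [U /maxsetP[/forall_inP PU maxU] _] := maxset_exists P0.
have cover : psupp p \subset U :|: (p @: U :|: p @^-1: U).
  apply/fintype.subsetP => x; rewrite 3!inE => px; rewrite !inE.
  apply/norP => -[xU /norP[xpU pxU]].
  (* An uncovered moved point could be added to [U], against maximality. *)
  have PxU : P (x |: U).
    apply/forall_inP => y /setU1P[->|yU]; rewrite !inE negb_or ?px //.
    rewrite PU // andbT; apply: contra xpU => /eqP <-; exact: imset_f.
  have := maxU _ PxU (finset.subsetUr _ _) => eqU.
  by move: xU; rewrite -eqU !inE eqxx.
have mU : m <= #|U|.
  have := subset_leq_card cover.
  have := (leq_card_setU U (p @: U :|: p @^-1: U)).1.
  have := (leq_card_setU (p @: U) (p @^-1: U)).1.
  have := card_imset U (@perm_inj _ p).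
  have := card_preimset U (@perm_inj _ p).
  lia.
exists [ffun i => enum_val (widen_ord mU i)]; split=> [i j|i].
  by rewrite !ffunE => /enum_val_inj/(congr1 val)/=/val_inj.
rewrite ffunE; apply: contra (PU _ (enum_valP (widen_ord mU i))).
by move=> /codomP[j ->]; rewrite ffunE enum_valP.
Qed.

Lemma ffun_cover d (A : {set T}) (x0 : T) : #|A| <= d ->
  exists D : {ffun 'I_d -> T}, {subset A <= codom D}.
Proof.
(* Positions from [#|A|] on take the default [x0], which can only enlarge the range. *)
move=> Ad; exists [ffun i : 'I_d => nth x0 (enum A) i] => x xA.
have x_lt : index x (enum A) < d.
  by apply: leq_trans Ad; rewrite cardE index_mem mem_enum.
by apply/codomP; exists (Ordinal x_lt); rewrite ffunE nth_index // mem_enum.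
Qed.

Lemma near_twinsP G d (A : {set T}) u v : u != v -> #|A| <= d ->
    (forall x, x \notin A -> adj G u x = adj G v x) ->
  G \in \bigcup_t @near_twins d t.
Proof.
move=> uv Ad AG; have [D AD] := ffun_cover u Ad.
apply/bigcupP; exists (u, v, D) => //; rewrite inE uv; apply/forallP => x.
apply/implyP; rewrite mem_cat negb_or => /andP[_ xD]; apply/eqP/AG.
by apply: contra xD; apply: AD.
Qed.

Lemma autpi_nontrivial_sub m :
  [set G : sgraph T | autpi_group G != 1%G] \subset
  (\bigcup_t @folded_clique m t) :|: (\bigcup_t @near_twins (3 * m) t).
Proof.
apply/fintype.subsetP => G; rewrite inE => nontriv; apply/setUP.
have [p /autpiP pG p1] : exists2 p, p \in autpi G & p != 1%g.
  apply/exists_inP; apply: contraR nontriv; rewrite negb_exists_in.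
  move=> /forall_inP triv; rewrite -val_eqE /= finset.eqEsubset sub1G andbT.
  by apply/fintype.subsetP => p /triv; rewrite negbK inE.
have adj_p v w x : p @: nbh G v = nbh G w -> adj G w (p x) = adj G v x.
  by move=> /finset.setP/(_ (p x)); rewrite (mem_imset _ _ (@perm_inj _ p)) !inE.
have [m_le|/ltnW lt_m] := leqP (3 * m) #|psupp p|; [left | right].
  have [u [u_inj pu]] := psupp_displaced m_le.
  have [w pw] := fin_all_exists pG.
  apply/bigcupP; exists (u, [ffun i => w (u i)], [ffun i => p (u i)]) => //.
  rewrite inE; apply/and3P; split; first exact/injectiveP.
    by apply/forallP => i; rewrite ffunE.
  by apply/forallP => i; apply/forallP => j; rewrite !ffunE (adj_p _ _ _ (pw _)).
have [/existsP[v /existsP[w /andP[vw /eqP pv]]]|] :=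
    boolP [exists v, exists w, (v != w) && (p @: nbh G v == nbh G w)].
  (* The exceptional set is the support of [p]; outside it [p x = x]. *)
  apply: (near_twinsP vw lt_m) => x; rewrite inE negbK => /eqP px.
  by rewrite -(adj_p _ _ _ pv) px.
rewrite negb_exists => /forallP fixG.
have {}fixG v : p @: nbh G v = nbh G v.
  have [w pv] := pG v; have := fixG v; rewrite negb_exists => /forallP/(_ w).
  by rewrite pv eqxx andbT negbK => /eqP ->.
have [x px] : exists x, x != p x.
  apply/existsP; apply: contraR p1; rewrite negb_exists => /forallP p_id.
  by apply/eqP/permP => x; have := p_id x; rewrite negbK perm1 => /eqP.
(* As [p] fixes every neighbourhood, symmetry of [adj] makes [x] and [p x] exact twins. *)
apply: (near_twinsP px (A := finset.set0)); first by rewrite cards0.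
by move=> y _; rewrite adjC [RHS]adjC (adj_p _ _ _ (fixG y)).
Qed.

(** The two unions have [#|T| ^ (3 * m)] and [#|T| ^ (3 * m).+2] members; the extra power of [#|T|]
    in each hypothesis brings each probability down to [1/#|T|]. *)
Lemma card_autpi_nontrivial m :
    #|T| ^ (3 * m).+1 <= 2 ^ 'C(m, 2) ->
    #|T| ^ (3 * m).+3 <= 2 ^ (#|T| - (2 + 3 * m)) ->
  #|[set G : sgraph T | autpi_group G != 1%G]| * #|T| <= 2 * 2 ^ 'C(#|T|, 2).
Proof.
have [->|T0] := posnP #|T|; first by rewrite muln0.
move=> clique_le twins_le.
have := subset_leq_card (autpi_nontrivial_sub m).
have := (leq_card_setU (\bigcup_t @folded_clique m t) (\bigcup_t @near_twins (3 * m) t)).1.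
move=> le_add /leq_trans/(_ le_add) {le_add} le_add.
apply: leq_trans (leq_mul le_add (leqnn _)) _.
rewrite mulnDl mul2n -addnn; apply: leq_add.
  rewrite -(@leq_pmul2l (#|T| ^ (3 * m))) ?expn_gt0 ?T0 // mulnCA -expnSr.
  apply: leq_trans (leq_mul (leqnn _) clique_le) _.
  have := card_bigcup_le (@card_folded_clique m).
  by rewrite !card_prod !card_ffun !card_ord -!expnD !mulSn addnA addn0.
rewrite -(@leq_pmul2l (#|T| ^ (3 * m).+2)) ?expn_gt0 ?T0 // mulnCA -expnSr.
apply: leq_trans (leq_mul (leqnn _) twins_le) _.
have := card_bigcup_le (@card_near_twins (3 * m)).
by rewrite !card_prod card_ffun card_ord !expnS mulnA.
Qed.

End Events.

(** With K = [k.+1] and m = 8K, the left side is K(3m + 3) + (2 + 3m), the size of n that suffices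
    for the near-twin bound. The inequality fails at k = 12. *)
Lemma quadratic_le_exp2 k : 13 <= k -> 24 * (k.+1 * k.+1) + 27 * k.+1 + 2 <= 2 ^ k.
Proof.
elim: k => // k IH; rewrite leq_eqVlt => /orP[/eqP <- //|k13].
have := IH k13; rewrite expnS; move: (2 ^ k) => e; nia.
Qed.

Lemma exists_clique_size n : 2 ^ 13 <= n -> exists m,
  n ^ (3 * m).+1 <= 2 ^ 'C(m, 2) /\ n ^ (3 * m).+3 <= 2 ^ (n - (2 + 3 * m)).
Proof.
move=> n13; have n0 : 0 < n by apply: leq_trans n13; rewrite expn_gt0.
have /andP[n_ge /ltnW n_le] := trunc_log_bounds (isT : 1 < 2) n0.
have k13 : 13 <= trunc_log 2 n by apply: trunc_log_max.
move: (trunc_log 2 n) k13 n_ge n_le => k /quadratic_le_exp2 quad n_ge n_le.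
(* Put K = [k.+1], so n is at most 2^K. For m = cK, the exponent ['C(m, 2)], about c^2 K^2 / 2, must
   beat about 3c K^2, which asks for c > 6. *)
exists (8 * k.+1).
have n_exp j : n ^ j <= 2 ^ (k.+1 * j) by rewrite expnM; case: j => // j; rewrite leq_exp2r.
split; apply: leq_trans (n_exp _) _; rewrite leq_exp2l //.
  have -> : 'C(8 * k.+1, 2) = (4 * k.+1) * (8 * k.+1).-1.
    by rewrite bin2 -[RHS]doubleK -mul2n !mulnA.
  nia.
have := leq_trans quad n_ge; nia.
Qed.

Theorem theorem6p4 (R : realType) :
  (prob_autpi_nontrivial R n @[n --> \oo] --> (0 : R)%R)%classic.
Proof.
apply: (@squeeze_cvgr _ _ _ _ (fun=> 0%R) (fun n => 2%:R * n%:R^-1)%R).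
- near=> n; rewrite divr_ge0 ?ler0n //=.
  have n13 : 2 ^ 13 <= n by near: n; exact: nbhs_infty_ge.
  have n0 : 0 < n by apply: leq_trans n13; rewrite expn_gt0.
  have [m [clique_le twins_le]] := exists_clique_size n13.
  have := @card_autpi_nontrivial 'I_n m; rewrite card_ord => /(_ clique_le twins_le).
  rewrite /prob_autpi_nontrivial card_sgraph card_ord => bad_le.
  rewrite ler_pdivrMr ?ltr0n ?expn_gt0 // mulrAC ler_pdivlMr ?ltr0n //.
  by rewrite -!natrM ler_nat.
- exact: cvg_cst.
- rewrite -[X in (_ --> X)%classic](mulr0 2%:R)%R; apply: cvgMr.
  apply/gtr0_cvgV0; last exact: cvgr_idn.
  by near=> n; rewrite ltr0n; near: n; exact: nbhs_infty_gt.
Unshelve. all: by end_near.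
Qed.
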